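(* Let $\hat U\in\operatorname{St}(n,p)$. For every $\xi\in T_{\hat U}\operatorname{St}(n,p)$, the absolute condition of $\mathcal{R}_{\hat U}$ at $\xi$ is bounded by $$\|d(\mathcal{R}_{\hat U})_\xi\|_F\le 2.$$
   Context: Let $p\le n$ be positive integers. $\operatorname{St}(n,p)=\{U\in\mathbb{R}^{n\times p}: U^TU=I_p\}$ is the Stiefel manifold, with tangent spaces $T_{\hat U}\operatorname{St}(n,p)=\{\xi\in\mathbb{R}^{n\times p}:\hat U^T\xi+\xi^T\hat U=0\}$. With $\operatorname{Cay}(A)=(I-A)^{-1}(I+A)$, the canonical Cayley retraction at $\hat U$ is the map on $T_{\hat U}\operatorname{St}(n,p)$ $$\mathcal{R}_{\hat U}(\xi)=\operatorname{Cay}\left(\tfrac12\left(P_{\hat U}\xi\hat U^T-\hat U\xi^TP_{\hat U}\right)\right)\hat U\in\operatorname{St}(n,p),\qquad P_{\hat U}=I_n-\tfrac12\hat U\hat U^T.$$ The absolute condition of a differentiable map $F$ at a point is the operator norm of its differential there. For a linear map $L$ between matrix vector spaces, $\|L\|_F=\sup_{M\ne0}\|LM\|_F/\|M\|_F$ is the operator norm induced by the Frobenius norm. *)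

(* Defs.v *)
From HB Require Import structures.
From mathcomp Require Import all_boot all_order all_algebra.
From mathcomp Require Import all_classical all_reals all_analysis.
Set Implicit Arguments.
Unset Strict Implicit.
Unset Printing Implicit Defensive.
Import Order.TTheory GRing.Theory Num.Theory.
Import numFieldNormedType.Exports.

Local Open Scope classical_set_scope.
Local Open Scope ring_scope.

Definition stiefel (R : realType) (n p : nat) : set 'M[R]_(n, p) :=
  [set U | U^T *m U = 1%:M].
Arguments stiefel {R} n p.

Section Tangent.
Variables (R : realType) (n p : nat) (U : 'M[R]_(n, p)).

Definition tangent_pred : {pred 'M[R]_(n, p)} :=
  fun xi => U^T *m xi + xi^T *m U == 0.

(* The tangent space T_U St(n, p) as a type of its own, so that the retraction
   has it as its domain and its differential is a linear map defined on it. *)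
Record tangent := Tangent {
  tangent_val :> 'M[R]_(n, p);
  tangent_valP : tangent_val \in tangent_pred }.

HB.instance Definition _ := [isSub for tangent_val].
HB.instance Definition _ := [Choice of tangent by <:].

Fact tangent_submod_closed : submod_closed tangent_pred.
Proof.
split=> [|a x y]; rewrite !unfold_in ?mulmx0 ?trmx0 ?mul0mx ?addr0 //.
move=> /eqP hx /eqP hy.
by rewrite mulmxDr linearP mulmxDl /= -scalemxAr -scalemxAl addrACA -scalerDr
  hx hy scaler0 addr0.
Qed.

HB.instance Definition _ :=
  GRing.isSubmodClosed.Build R 'M[R]_(n, p) tangent_pred tangent_submod_closed.
HB.instance Definition _ := [SubChoice_isSubLmodule of tangent by <:].

(* [tangent] is normed by restricting the library's (entrywise maximum) norm of
   matrices. It is only used for the topology, that is, for what the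
   differential is: all norms on a finite dimensional space are equivalent.
   Operator norms below are taken with respect to [frobenius]. *)
Let tangent_norm (x : tangent) : R := `|val x|.

Let tangent_normD x y :
  tangent_norm (x + y) <= tangent_norm x + tangent_norm y.
Proof. exact: ler_normD. Qed.

Let tangent_normZ (a : R) x : tangent_norm (a *: x) = `|a| * tangent_norm x.
Proof. exact: normrZ. Qed.

Let tangent_norm0_eq0 x : tangent_norm x = 0 -> x = 0.
Proof. by move=> /normr0_eq0 x0; apply: val_inj. Qed.

HB.instance Definition _ := Lmodule_isNormed.Build R tangent
  tangent_normD tangent_normZ tangent_norm0_eq0.

End Tangent.

Definition frobenius (R : realType) (m n : nat) (M : 'M[R]_(m, n)) : R :=
  Num.sqrt (\sum_i \sum_j M i j ^+ 2).

(* The supremum is taken in [0, +oo], whence the element 0: it only matters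
   when the tangent space is trivial (n = p = 1), where the norm is then 0. *)
Definition frobenius_opnorm (R : realType) (n p : nat) (U : 'M[R]_(n, p))
    (L : tangent U -> 'M[R]_(n, p)) : \bar R :=
  ereal_sup (0%E |` [set (frobenius (L M) / frobenius (val M))%:E
                    | M in [set M : tangent U | M != 0]]).

Definition absolute_condition (R : realType) (n p : nat) (U : 'M[R]_(n, p))
    (F : tangent U -> 'M[R]_(n, p)) (xi : tangent U) : \bar R :=
  frobenius_opnorm ('d F xi).

(* [invmx] is a total function, but here Cay is only applied to skew-symmetric
   matrices A, for which I - A is invertible. *)
Definition Cay (R : realType) (n : nat) (A : 'M[R]_n) : 'M[R]_n :=
  invmx (1%:M - A) *m (1%:M + A).

Definition cayley_proj (R : realType) (n p : nat) (U : 'M[R]_(n, p)) : 'M[R]_n :=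
  1%:M - 2^-1 *: (U *m U^T).

Definition cayley_retraction (R : realType) (n p : nat) (U : 'M[R]_(n, p))
    (xi : tangent U) : 'M[R]_(n, p) :=
  Cay (2^-1 *: (cayley_proj U *m val xi *m U^T
                - U *m (val xi)^T *m cayley_proj U)) *m U.

(* Main.v *)
(* Write A(M) = (P M U^T - U M^T P) / 2, a skew-symmetric matrix that is linear
   in M.  Since Cay(A) = 2 (I - A)^-1 - I, the differential of the retraction
   at xi is M |-> 2 (I - A(xi))^-1 A(M) (I - A(xi))^-1 U.  Multiplication by U
   on the right and by (I - A)^-1 with A skew on either side do not increase
   the Frobenius norm, and neither does M |-> A(M).  Expanding the resolvent to
   second order bounds the remainder by a multiple of |M|^2 for all M, which
   also gives differentiability. *)

From HB Require Import structures.
Require Import Defs.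
From mathcomp Require Import all_boot all_order all_algebra.
From mathcomp Require Import all_classical all_reals all_analysis.
From mathcomp Require Import lra.
Import Order.TTheory GRing.Theory Num.Theory.
Import numFieldNormedType.Exports.
Set Implicit Arguments.
Unset Strict Implicit.
Local Open Scope classical_set_scope.
Local Open Scope ring_scope.

(** * The Frobenius norm in trace form, and its comparison with the entrywise maximum norm *)

Section Frobenius.
Context {R : realType}.

Lemma frobenius_sum_tr m n (M : 'M[R]_(m, n)) :
  \sum_i \sum_j M i j ^+ 2 = \tr (M^T *m M).
Proof.
rewrite exchange_big; apply: eq_bigr => j _; rewrite mxE.
by apply: eq_bigr => i _; rewrite mxE expr2.
Qed.

Lemma mxtrace_trmx_mul_ge0 m n (M : 'M[R]_(m, n)) : 0 <= \tr (M^T *m M).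
Proof.
rewrite -frobenius_sum_tr.
by apply: sumr_ge0 => i _; apply: sumr_ge0 => j _; exact: sqr_ge0.
Qed.

Lemma frobenius_ge0 m n (M : 'M[R]_(m, n)) : 0 <= frobenius M.
Proof. exact: sqrtr_ge0. Qed.

Lemma sqr_frobenius m n (M : 'M[R]_(m, n)) :
  frobenius M ^+ 2 = \tr (M^T *m M).
Proof. by rewrite /frobenius frobenius_sum_tr sqr_sqrtr ?mxtrace_trmx_mul_ge0. Qed.

(** Turns norm comparisons into inequalities between traces, which become linear arithmetic once
    products are expanded. *)
Lemma ler_frobenius m n m' n' (M : 'M[R]_(m, n)) (N : 'M[R]_(m', n')) :
  (frobenius M <= frobenius N) = (\tr (M^T *m M) <= \tr (N^T *m N)).
Proof.
by rewrite -!sqr_frobenius ler_pXn2r ?nnegrE ?frobenius_ge0.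
Qed.

Lemma frobenius_tr m n (M : 'M[R]_(m, n)) : frobenius M^T = frobenius M.
Proof.
apply/eqP; rewrite eq_le !ler_frobenius !trmxK [\tr (M *m _)]mxtrace_mulC.
by rewrite lexx.
Qed.

Lemma frobeniusZ m n (a : R) (M : 'M[R]_(m, n)) :
  0 <= a -> frobenius (a *: M) = a * frobenius M.
Proof.
move=> a0; apply/eqP; rewrite -(@eqrXn2 _ 2) ?mulr_ge0 ?frobenius_ge0 //.
rewrite exprMn !sqr_frobenius [(_ *: _)^T]linearZ /= -scalemxAl -scalemxAr.
by rewrite scalerA mxtraceZ expr2.
Qed.

Lemma normr_le_frobenius m n (M : 'M[R]_(m, n)) : `|M| <= frobenius M.
Proof.
rewrite [leLHS]/Num.norm/= mx_normrE; apply/bigmax_leP.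
split=> [|[i j] _ /=]; first exact: frobenius_ge0.
rewrite -sqrtr_sqr ler_wsqrtr// (bigD1 i)//= (bigD1 j)//= -addrA lerDl.
apply: addr_ge0; first by apply: sumr_ge0 => k _; exact: sqr_ge0.
by apply: sumr_ge0 => k _; apply: sumr_ge0 => l _; exact: sqr_ge0.
Qed.

Lemma normr_mx_entry m n (M : 'M[R]_(m, n)) i j : `|M i j| <= `|M|.
Proof.
rewrite [leRHS]/Num.norm/= mx_normrE.
by apply/bigmax_geP; right; exists (i, j).
Qed.

Lemma frobenius_le_normr m n (M : 'M[R]_(m, n)) :
  frobenius M <= Num.sqrt (m * n)%:R * `|M|.
Proof.
rewrite -(@ler_pXn2r _ 2) ?nnegrE ?mulr_ge0 ?frobenius_ge0 ?sqrtr_ge0 //.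
rewrite exprMn sqr_frobenius -frobenius_sum_tr sqr_sqrtr ?ler0n//.
apply: (@le_trans _ _ (\sum_(i < m) \sum_(j < n) `|M| ^+ 2)).
  apply: ler_sum => i _; apply: ler_sum => j _.
  by rewrite -real_normK ?num_real// ler_pXn2r ?nnegrE ?normr_mx_entry.
by rewrite !sumr_const !card_ord -mulrnA mulr_natl mulnC.
Qed.

Lemma normr_mulmx m n p (M : 'M[R]_(m, n)) (N : 'M[R]_(n, p)) :
  `|M *m N| <= n%:R * (`|M| * `|N|).
Proof.
rewrite [leLHS]/Num.norm/= mx_normrE; apply/bigmax_leP.
split=> [|[i j] _ /=]; first by rewrite !mulr_ge0.
rewrite mxE; apply: le_trans (ler_norm_sum _ _ _) _.
have -> : n%:R * (`|M| * `|N|) = \sum_(k < n) `|M| * `|N|.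
  by rewrite sumr_const card_ord mulr_natl.
apply: ler_sum => k _.
by rewrite normrM ler_pM ?normr_mx_entry.
Qed.

(** A crude dimensional constant, obtained through the maximum norm, suffices: the bound only serves
    the remainder estimate. *)
Lemma frobenius_mulmx m n p (M : 'M[R]_(m, n)) (N : 'M[R]_(n, p)) :
  frobenius (M *m N)
    <= Num.sqrt (m * p)%:R * n%:R * (frobenius M * frobenius N).
Proof.
apply: le_trans (frobenius_le_normr _) _.
rewrite -mulrA ler_wpM2l ?sqrtr_ge0//; apply: le_trans (normr_mulmx _ _) _.
by rewrite ler_wpM2l// ler_pM ?normr_le_frobenius.
Qed.

(* By the parallelogram law. *)
Lemma sqr_frobeniusB_le m n (M N : 'M[R]_(m, n)) :
  frobenius (M - N) ^+ 2 <= 2 * frobenius M ^+ 2 + 2 * frobenius N ^+ 2.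
Proof.
have := mxtrace_trmx_mul_ge0 (M + N).
rewrite !sqr_frobenius !linearD/= !linearN/= !(mulmxDl, mulmxDr).
rewrite !(mulmxN, mulNmx) !linearD/= !linearN/=; lra.
Qed.

(** * Multiplication by a matrix with orthonormal columns *)

Section Orthonormal.
Context {n p : nat} {U : 'M[R]_(n, p)} (hU : stiefel n p U).

Lemma frobenius_mul_tr_stiefel m (M : 'M[R]_(m, p)) :
  frobenius (M *m U^T) = frobenius M.
Proof.
rewrite -[LHS]frobenius_tr -[RHS]frobenius_tr trmx_mul trmxK.
by apply/eqP; rewrite eq_le !ler_frobenius !trmx_mul trmxK -mulmxA
  [U^T *m _]mulmxA hU mul1mx lexx.
Qed.

(** As $UU^T$ is an orthogonal projection, $|M|^2 - |U^TM|^2 = |M - UU^TM|^2 \ge 0$. *)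
Lemma frobenius_tr_stiefel_mul m (M : 'M[R]_(n, m)) :
  frobenius (U^T *m M) <= frobenius M.
Proof.
rewrite ler_frobenius; have := mxtrace_trmx_mul_ge0 (M - U *m (U^T *m M)).
rewrite !linearB/= !trmx_mul !trmxK !(mulmxBl, mulmxBr) !mulmxA.
rewrite -[_ *m U^T *m U]mulmxA hU mulmx1 subrr mxtrace0 subr0 !linearB/=; lra.
Qed.

Lemma frobenius_mul_stiefel m (M : 'M[R]_(m, n)) :
  frobenius (M *m U) <= frobenius M.
Proof.
rewrite -frobenius_tr -[leRHS]frobenius_tr trmx_mul.
exact: frobenius_tr_stiefel_mul.
Qed.

(** Since $P^TP = I - \frac34 UU^T$, one has $|M|^2 - |PM|^2 = \frac34 |U^TM|^2$. *)
Lemma frobenius_cayley_proj m (M : 'M[R]_(n, m)) :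
  frobenius (cayley_proj U *m M) <= frobenius M.
Proof.
rewrite ler_frobenius /cayley_proj mulmxBl mul1mx -scalemxAl.
have := mxtrace_trmx_mul_ge0 (U^T *m M).
rewrite [(_ - _)^T]linearB/= [(_ *: _)^T]linearZ/= !trmx_mul !trmxK.
rewrite !(mulmxBl, mulmxBr) -!(scalemxAl, scalemxAr) !mulmxA.
rewrite -[_ *m U^T *m U]mulmxA hU mulmx1 !raddfB/= !mxtraceZ; lra.
Qed.

End Orthonormal.

End Frobenius.

(** * Resolvents of skew-symmetric matrices *)

Section SkewResolvent.
Context {R : realType} {n : nat} {A : 'M[R]_n} (skewA : A^T = - A).

(* The cross terms of |M - A M|^2 cancel, so it equals |M|^2 + |A M|^2. *)
Lemma frobenius_le_skew_mul m (M : 'M[R]_(n, m)) :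
  frobenius M <= frobenius ((1%:M - A) *m M).
Proof.
rewrite ler_frobenius mulmxBl mul1mx [(_ - _)^T]linearB/= trmx_mul skewA.
rewrite mulmxN opprK.
have := mxtrace_trmx_mul_ge0 (A *m M); rewrite trmx_mul skewA mulmxN mulNmx.
rewrite !(mulmxDl, mulmxBr) !mulmxA !raddfD/= !raddfN/=; lra.
Qed.

End SkewResolvent.

Section SkewResolventInverse.
Context {R : realType} {n : nat} {A : 'M[R]_n} (skewA : A^T = - A).

Let skewN : (- A)^T = - - A.
Proof. by rewrite linearN /= skewA. Qed.

Let tr_resolvent : (1%:M - A)^T = 1%:M - - A.
Proof. by rewrite linearB/= trmx1 skewA. Qed.

Lemma unitmx_sub_skew : 1%:M - A \in unitmx.
Proof.
(* A left kernel $K$ of $I - A$ satisfies $(I + A)K^T = 0$, so the lower bound for $-A$ forces $K =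
   0$. *)
rewrite -row_free_unit -kermx_eq0 -trmx_eq0 -normr_le0.
apply: le_trans (normr_le_frobenius _) _.
apply: le_trans (frobenius_le_skew_mul skewN _) _.
rewrite -tr_resolvent -trmx_mul mulmx_ker trmx0.
by rewrite -(scale0r (0 : 'M[R]_n)) frobeniusZ// mul0r.
Qed.

Lemma frobenius_skew_inv_mul m (M : 'M[R]_(n, m)) :
  frobenius (invmx (1%:M - A) *m M) <= frobenius M.
Proof.
apply: le_trans (frobenius_le_skew_mul skewA _) _.
by rewrite mulKVmx ?unitmx_sub_skew.
Qed.

End SkewResolventInverse.

Lemma frobenius_mul_skew_inv (R : realType) m n (A : 'M[R]_n)
    (M : 'M[R]_(m, n)) : A^T = - A ->
  frobenius (M *m invmx (1%:M - A)) <= frobenius M.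
Proof.
move=> skewA; rewrite -frobenius_tr -[leRHS]frobenius_tr trmx_mul trmx_inv.
rewrite linearB/= trmx1 skewA; apply: frobenius_skew_inv_mul.
by rewrite linearN/= skewA.
Qed.

(** * Algebra of the Cayley transform and of perturbed inverses *)

Lemma CayE (R : realType) n (A : 'M[R]_n) : 1%:M - A \in unitmx ->
  Cay A = 2 *: invmx (1%:M - A) - 1%:M.
Proof.
(* Uses $I + A = 2I - (I - A)$. *)
move=> uA; rewrite /Cay -[X in _ = _ - X](mulVmx uA) -mul_mx_scalar -mulmxBr.
congr (_ *m _); rewrite opprB addrCA addrC; congr (_ + _).
by rewrite -[2]/(1 + 1) raddfD/= addrK.
Qed.

(** The resolvent identity, applied once on each side, gives an exact remainder that is quadratic in
    $D$. *)
Lemma invmxB_expansion (R : realType) n (B D : 'M[R]_n) :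
  B \in unitmx -> B - D \in unitmx ->
  invmx (B - D) - invmx B - invmx B *m D *m invmx B =
  invmx B *m D *m invmx (B - D) *m D *m invmx B.
Proof.
move=> uB uBD.
have EB : invmx (B - D) = invmx B + invmx (B - D) *m D *m invmx B.
  apply: (can_inj (mulKmx uBD)); rewrite mulmxDr !mulmxA mulmxV// mul1mx.
  by rewrite mulmxBl mulmxV// subrK.
have BE : invmx (B - D) = invmx B + invmx B *m D *m invmx (B - D).
  apply: (can_inj (mulmxK uBD)); rewrite mulmxDl mulVmx// mulmxKV//.
  by rewrite mulmxBr mulVmx// subrK.
rewrite [in LHS]EB [invmx B + _]addrC addrK {1}BE !mulmxDl.
by rewrite [X in X - _]addrC addrK.
Qed.

(** * The skew generator and the candidate differential *)

Section Retraction.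
Context {R : realType} {n p : nat} (U : 'M[R]_(n, p)).

Definition cayley_generator (M : 'M[R]_(n, p)) : 'M[R]_n :=
  2^-1 *: (cayley_proj U *m M *m U^T - U *m M^T *m cayley_proj U).

Fact cayley_generator_is_linear : linear cayley_generator.
Proof.
move=> a M N; rewrite /cayley_generator; move: (cayley_proj U) => P.
rewrite [(_ + _)^T]linearP/= !mulmxDr !mulmxDl.
rewrite -!(scalemxAl, scalemxAr) opprD addrACA -scalerBr scalerDr.
by rewrite !scalerA [2^-1 * a]mulrC.
Qed.
HB.instance Definition _ :=
  GRing.isLinear.Build R 'M[R]_(n, p) 'M[R]_n _ cayley_generator
    cayley_generator_is_linear.

Lemma tr_cayley_proj : (cayley_proj U)^T = cayley_proj U.
Proof. by rewrite linearB/= linearZ/= trmx1 trmx_mul trmxK. Qed.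

Lemma tr_cayley_generator M : (cayley_generator M)^T = - cayley_generator M.
Proof.
rewrite linearZ/= linearB/= !trmx_mul !trmxK tr_cayley_proj !mulmxA.
by rewrite -scalerN opprB.
Qed.

(** The generator is the skew part of $X = PMU^T$, and taking the skew part does not increase the
    norm, by the parallelogram law. *)
Lemma frobenius_cayley_generator M :
  stiefel n p U -> frobenius (cayley_generator M) <= frobenius M.
Proof.
move=> hU; set X := cayley_proj U *m M *m U^T.
have XM : frobenius X <= frobenius M.
  by rewrite frobenius_mul_tr_stiefel//; exact: frobenius_cayley_proj.
have -> : cayley_generator M = 2^-1 *: (X - X^T).
  by rewrite /X !trmx_mul trmxK tr_cayley_proj mulmxA.
apply: le_trans XM; rewrite frobeniusZ ?invr_ge0//.
rewrite -(@ler_pXn2r _ 2) ?nnegrE ?mulr_ge0 ?invr_ge0 ?frobenius_ge0//.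
have := sqr_frobeniusB_le X X^T; rewrite frobenius_tr exprMn; lra.
Qed.

Definition cayley_differential (xi M : tangent U) : 'M[R]_(n, p) :=
  let J := invmx (1%:M - cayley_generator (val xi)) in
  2 *: (J *m cayley_generator (val M) *m J *m U).

Fact cayley_differential_is_linear xi : linear (cayley_differential xi).
Proof.
move=> a M N; rewrite /cayley_differential.
rewrite [cayley_generator (val (_ + _))]linearP/= mulmxDr !mulmxDl.
move: (cayley_generator (val M)) (cayley_generator (val N)) => X Y.
by rewrite -!(scalemxAl, scalemxAr) scalerDr !scalerA [2 * a]mulrC.
Qed.
HB.instance Definition _ xi :=
  GRing.isLinear.Build R (tangent U) 'M[R]_(n, p) _ (cayley_differential xi)
    (cayley_differential_is_linear xi).

Hypothesis hU : stiefel n p U.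

(** The explicit factor 2 is the whole constant: $U$, the two resolvents and the generator are
    removed in turn, each being nonexpansive. *)
Lemma frobenius_cayley_differential xi M :
  frobenius (cayley_differential xi M) <= 2 * frobenius (val M).
Proof.
rewrite frobeniusZ// ler_wpM2l//.
apply: le_trans (frobenius_mul_stiefel hU _) _.
apply: le_trans (frobenius_mul_skew_inv _ (tr_cayley_generator _)) _.
apply: le_trans (frobenius_skew_inv_mul (tr_cayley_generator _) _) _.
exact: frobenius_cayley_generator.
Qed.

(** * Continuity, quadratic remainder and differentiability *)

Lemma continuous_cayley_differential xi : continuous (cayley_differential xi).
Proof.
apply/linear_bounded_continuous/linear_boundedP.
(* Passing to the maximum norm turns the bound 2 into $2\sqrt{np}$. *)
near=> r => M; apply: le_trans (normr_le_frobenius _) _.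
apply: le_trans (frobenius_cayley_differential _ _) _.
apply: le_trans (ler_wpM2l _ (frobenius_le_normr _)) _ => //.
rewrite mulrA ler_wpM2r//; near: r; exact: nbhs_pinfty_ge.
Unshelve. all: by end_near. Qed.

(** The bound is global in [M]: the generators at [xi] and at [M + xi] are both skew, so both
    resolvents exist and are nonexpansive. *)
Lemma cayley_retraction_remainder xi :
  exists2 C : R, 0 < C & forall M : tangent U,
    `|cayley_retraction (M + xi) - cayley_retraction xi
        - cayley_differential xi M| <= C * `|M| ^+ 2.
Proof.
pose c : R := Num.sqrt (n * n)%:R * n%:R.
pose k : R := Num.sqrt (n * p)%:R.
have c0 : 0 <= c by rewrite mulr_ge0 ?sqrtr_ge0.
have k0 : 0 <= k by rewrite sqrtr_ge0.
(* The summand 1 keeps the constant positive even if [n] or [p] is 0; it is divided by later. *)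
exists (2 * c * k ^+ 2 + 1).
  by rewrite ltr_wpDl// mulr_ge0 ?mulr_ge0 ?sqr_ge0.
move=> M; pose D := cayley_generator (val M).
pose A := cayley_generator (val xi); pose B := 1%:M - A.
have BD : 1%:M - cayley_generator (val (M + xi)) = B - D.
  by rewrite !linearD/= [_ + - _]addrC addrA.
have uB : B \in unitmx := unitmx_sub_skew (tr_cayley_generator _).
have uBD : B - D \in unitmx.
  by rewrite -BD unitmx_sub_skew// tr_cayley_generator.
(* The identity terms of the two Cayley transforms cancel. The grouping leaves a single product, [D]
   times [invmx (B - D) *m D], to be estimated by [frobenius_mulmx]. *)
have -> : cayley_retraction (M + xi) - cayley_retraction xi
    - cayley_differential xi M =
    2 *: (invmx B *m (D *m (invmx (B - D) *m D)) *m invmx B *m U).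
  rewrite /cayley_retraction -!/(cayley_generator _).
  rewrite !CayE ?BD// -/A -/B -mulmxBl opprB addrA subrK -scalerBr.
  rewrite /cayley_differential -/A -/B -/D -scalemxAl -scalerBr -mulmxBl.
  by rewrite invmxB_expansion// !mulmxA.
apply: le_trans (normr_le_frobenius _) _; rewrite frobeniusZ//.
have kM : frobenius D <= k * `|M|.
  apply: le_trans (frobenius_cayley_generator _ hU) _.
  exact: frobenius_le_normr.
apply: (@le_trans _ _ (2 * (c * (k * `|M|) ^+ 2))).
  rewrite ler_wpM2l//; apply: le_trans (frobenius_mul_stiefel hU _) _.
  apply: le_trans (frobenius_mul_skew_inv _ (tr_cayley_generator _)) _.
  apply: le_trans (frobenius_skew_inv_mul (tr_cayley_generator _) _) _.
  apply: le_trans (frobenius_mulmx _ _) _; rewrite ler_wpM2l// expr2.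
  rewrite ler_pM ?frobenius_ge0//; apply: le_trans kM.
  by rewrite -BD frobenius_skew_inv_mul// tr_cayley_generator.
have := sqr_ge0 `|M|; lra.
Qed.

Lemma cayley_retraction_expansion xi :
  @cayley_retraction R n p U \o shift xi =
  cst (cayley_retraction xi) + cayley_differential xi +o_ (0 : tangent U) id.
Proof.
have [C C0 hC] := cayley_retraction_remainder xi.
apply/eqaddoP => e e0; near=> M.
rewrite /= -[X in `|X|]/(cayley_retraction (M + xi)
  - (cayley_retraction xi + cayley_differential xi M)) opprD addrA.
(* One factor [|M|] is kept; the other is below [e / C] near 0. *)
apply: le_trans (hC M) _; rewrite expr2 mulrA ler_wpM2r//.
rewrite mulrC -ler_pdivlMr//; apply: ltW; near: M.
by apply: nbhs0_lt; rewrite divr_gt0.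
Unshelve. all: by end_near. Qed.

Lemma diff_cayley_retraction xi :
  'd (@cayley_retraction R n p U) xi = cayley_differential xi
    :> (tangent U -> 'M[R]_(n, p)).
Proof.
apply: diff_unique; first exact: continuous_cayley_differential.
exact: cayley_retraction_expansion.
Qed.

End Retraction.

Theorem lemma3p12 (R : realType) (n p : nat) (hp : (0 < p)%N) (hpn : (p <= n)%N)
    (U : 'M[R]_(n, p)) (hU : stiefel n p U) (xi : tangent U) :
  differentiable (@cayley_retraction R n p U) xi /\
  (absolute_condition (@cayley_retraction R n p U) xi <= 2%:E)%E.
Proof.
split.
  (* This criterion mentions ['d] itself, so the differential is identified first, by uniqueness of
     the linear term of an expansion. *)
  apply/diff_locallyP; rewrite diff_cayley_retraction//; split.
    exact: continuous_cayley_differential.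
  exact: cayley_retraction_expansion.
rewrite /absolute_condition /frobenius_opnorm diff_cayley_retraction//.
apply: ge_ereal_sup => _ [->|[M _ <-]]; rewrite lee_fin//.
(* A zero denominator gives quotient 0, as [0^-1 = 0]. *)
have [->|M0] := eqVneq (frobenius (val M)) 0; first by rewrite invr0 mulr0.
rewrite ler_pdivrMr ?frobenius_cayley_differential//.
by rewrite lt_def M0 frobenius_ge0.
Qed.
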